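(* Let $f,g\in\mathbb{C}[x_1,\ldots,x_n]$ be two non-constant polynomials, let $m\ge 0$ and $N\ge 1$ be integers, and let $<$ be a monomial well-ordering on $D[s]$. Assume $b^{(N)}_{\frac fg,m}(s)\ne 0$. Let $$J=I_{m+N}(s)+D[s]\langle fg^{N-1},f^2g^{N-2},\ldots,f^N\rangle,$$ let $G$ be a (left) Gröbner basis of $J$ with respect to $<$, and for $k\ge 0$ let $P_k=\mathrm{NF}(s^kg^N,G)$ be the remainder (fully reduced normal form) of the left division of $s^kg^N$ by $G$. Then there exists $k\geq 0$ such that $P_0,\ldots,P_k$ satisfy a relation $a_0P_0+\cdots+a_kP_k=0$ with $a_0,\ldots,a_k\in\mathbb{C}$ and $a_k=1$, and for the smallest such $k$ (which is $k=0$ exactly when $P_0=0$) one has $$b^{(N)}_{\frac fg,m}(s)=a_0+a_1s+\cdots+a_ks^k.$$ In other words, the procedure that computes $P_0,P_1,P_2,\ldots$ successively, stops at the first $k$ for which such a relation exists and returns $a_0+a_1s+\cdots+a_ks^k$ terminates and returns $b^{(N)}_{\frac fg,m}(s)$.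
   Context: $D=\mathbb{C}[x_1,\ldots,x_n]\langle\partial_1,\ldots,\partial_n\rangle$ is the $n$th Weyl algebra over $\mathbb{C}$ (with $\partial_i x_i=x_i\partial_i+1$) and $D[s]=D\otimes_{\mathbb{C}}\mathbb{C}[s]$, with $s$ a central variable. The free rank-one module $\mathbb{C}[x,s,\frac1{fg}]\left(\frac fg\right)^s$ is a left $D[s]$-module: polynomials in $x,s$ act by multiplication and $\partial_i\bullet u\left(\frac fg\right)^s=\left(\frac{\partial u}{\partial x_i}+s\,u\,\frac{\partial f/\partial x_i}{f}-s\,u\,\frac{\partial g/\partial x_i}{g}\right)\left(\frac fg\right)^s$ for $u\in\mathbb{C}[x,s,\frac1{fg}]$. Here $\left(\frac fg\right)^{s+k}$ means $\frac{f^k}{g^k}\left(\frac fg\right)^s$. For an integer $k\ge0$, $I_k(s)=\mathrm{Ann}_{D[s]}\frac1{g^k}\left(\frac fg\right)^s\subset D[s]$. $b^{(N)}_{\frac fg,m}(s)$ is the monic generator (or $0$ if the ideal is zero) of the ideal of $\mathbb{C}[s]$ consisting of all $b(s)\in\mathbb{C}[s]$ for which there exist $P_1(s),\ldots,P_N(s)\in D[s]$ with $b(s)\frac1{g^m}\left(\frac fg\right)^s=\sum_{k=1}^N P_k(s)\frac1{g^m}\left(\frac fg\right)^{s+k}$. Gröbner bases and normal forms are with respect to the monomials $s^ix^\alpha\partial^\beta$ of $D[s]$: the normal form of $h$ with respect to a Gröbner basis $G$ of a left ideal $J$ is the unique element $r\in h+J$ none of whose monomials is divisible by a leading monomial of an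 element of $G$. *)

(* Defs.v *)
From HB Require Import structures.
From mathcomp Require Import all_boot all_order all_algebra.
From mathcomp Require Import mpoly complex.
From mathcomp Require Import reals ring.
From Stdlib Require Import ClassicalEpsilon.

Set Implicit Arguments.
Unset Strict Implicit.
Unset Printing Implicit Defensive.

Import GRing.Theory.
Local Open Scope ring_scope.
Local Open Scope quotient_scope.

Section WeylAdd.
Variables (n : nat) (K : fieldType).

(* An element of the Weyl algebra, in normally ordered form                   *)
(* \sum_b p_b(x) d^b, is stored as the polynomial with coefficients p_b in    *)
(* K[x] in the symbols d_1 ... d_n; the product is defined below and is not   *)
(* the product of these polynomials.                                          *)
Record weyl : Type := Weyl { wpoly : {mpoly {mpoly K[n]}[n]} }.

HB.instance Definition _ := [isNew for wpoly].
HB.instance Definition _ := [Choice of weyl by <:].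

Implicit Types P Q : weyl.

Lemma wpolyK : cancel wpoly Weyl. Proof. by case. Qed.

Definition wzero := Weyl 0.
Definition wopp P := Weyl (- wpoly P).
Definition wadd P Q := Weyl (wpoly P + wpoly Q).

Fact waddA : associative wadd.
Proof. by move=> P Q S; rewrite /wadd /= addrA. Qed.
Fact waddC : commutative wadd.
Proof. by move=> P Q; rewrite /wadd addrC. Qed.
Fact wadd0 : left_id wzero wadd.
Proof. by case=> P; rewrite /wadd /= add0r. Qed.
Fact waddN : left_inverse wzero wopp wadd.
Proof. by case=> P; rewrite /wadd /= addNr. Qed.

HB.instance Definition _ := GRing.isZmodule.Build weyl waddA waddC wadd0 waddN.

Lemma wpolyD P Q : wpoly (P + Q) = wpoly P + wpoly Q. Proof. by []. Qed.

Lemma wpoly0 : wpoly 0 = 0. Proof. by []. Qed.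

End WeylAdd.

HB.lock Definition wscale (n : nat) (K : fieldType) (p : {mpoly K[n]})
  (P : weyl n K) : weyl n K := Weyl (p *: wpoly P).

HB.lock Definition wdmon (n : nat) (K : fieldType) (b : 'X_{1..n}) : weyl n K :=
  Weyl 'X_[b].

Section WeylScale.
Variables (n : nat) (K : fieldType).
Implicit Types (p q : {mpoly K[n]}) (P Q : weyl n K).

Lemma wpoly_scale p P : wpoly (wscale p P) = p *: wpoly P.
Proof. by rewrite wscale.unlock. Qed.

Lemma wpoly_dmon b : wpoly (wdmon K b) = 'X_[b] :> {mpoly {mpoly K[n]}[n]}.
Proof. by rewrite wdmon.unlock. Qed.

Lemma wpoly_inj : injective (@wpoly n K).
Proof. exact: can_inj (@wpolyK n K). Qed.

Lemma wscaleDr p P Q : wscale p (P + Q) = wscale p P + wscale p Q.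
Proof. by apply: wpoly_inj; rewrite !(wpolyD, wpoly_scale) scalerDr. Qed.

Lemma wscaleDl p q P : wscale (p + q) P = wscale p P + wscale q P.
Proof. by apply: wpoly_inj; rewrite !(wpolyD, wpoly_scale) scalerDl. Qed.

Lemma wscaleM p q P : wscale (p * q) P = wscale p (wscale q P).
Proof. by apply: wpoly_inj; rewrite !wpoly_scale scalerA. Qed.

Lemma wscale1 P : wscale 1 P = P.
Proof. by apply: wpoly_inj; rewrite wpoly_scale scale1r. Qed.

Lemma wscale0 p : wscale p 0 = 0 :> weyl n K.
Proof. by apply: wpoly_inj; rewrite wpoly_scale wpoly0 scaler0. Qed.

Lemma weyl_ind (T : weyl n K -> Prop) :
    T 0 -> (forall p b Q, T Q -> T (wscale p (wdmon K b) + Q)) ->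
  forall P, T P.
Proof.
move=> T0 TS [P]; elim/mpolyind: P => // p b P _ _ TP.
suff -> : Weyl (p *: 'X_[b] + P) = wscale p (wdmon K b) + Weyl P by exact: TS.
by apply: wpoly_inj; rewrite wpolyD wpoly_scale wpoly_dmon.
Qed.

End WeylScale.

Lemma big_supp (M : zmodType) (I : eqType) (F : I -> M) (s d : seq I) :
    uniq s -> uniq d -> {subset s <= d} ->
    (forall b, b \notin s -> F b = 0) ->
  \sum_(b <- s) F b = \sum_(b <- d) F b.
Proof.
move=> us ud sd F0; rewrite [RHS](bigID (mem s)) /= [X in _ + X]big1 //.
rewrite addr0 -[RHS]big_filter; apply: perm_big; apply: uniq_perm => //.
  by rewrite filter_uniq.
by move=> b; rewrite mem_filter; case: (boolP (b \in s)) => // /sd ->.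
Qed.

Section Action.
Variables (n : nat) (K : fieldType) (M : zmodType).

(* Action of the Weyl algebra on a K[x]-module M, with scaling c, on which    *)
(* d_i acts as nabla i.                                                       *)
Variables (c : {mpoly K[n]} -> M -> M) (nabla : 'I_n -> M -> M).

Definition nabla_pow (b : 'X_{1..n}) (u : M) : M :=
  foldr (fun i v => iter (b i) (nabla i) v) u (enum 'I_n).

Definition weyl_act (P : weyl n K) (u : M) : M :=
  \sum_(b <- msupp (wpoly P)) c (wpoly P)@_b (nabla_pow b u).

Hypothesis cDr : forall p u v, c p (u + v) = c p u + c p v.
Hypothesis cDl : forall p q u, c (p + q) u = c p u + c q u.
Hypothesis cM : forall p q u, c (p * q) u = c p (c q u).
Hypothesis c1 : forall u, c 1 u = u.
Hypothesis nablaD : forall i u v, nabla i (u + v) = nabla i u + nabla i v.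
Hypothesis nablaC :
  forall i j u, nabla i (nabla j u) = nabla j (nabla i u).
Hypothesis nablaM :
  forall i p u, nabla i (c p u) = c p^`M(i) u + c p (nabla i u).

Lemma c0r p : c p 0 = 0.
Proof. by apply: (addrI (c p 0)); rewrite -cDr !addr0. Qed.

Lemma c0l u : c 0 u = 0.
Proof. by apply: (addrI (c 0 u)); rewrite -cDl !addr0. Qed.

Lemma nabla0 i : nabla i 0 = 0.
Proof. by apply: (addrI (nabla i 0)); rewrite -nablaD !addr0. Qed.

Lemma c_sum p (I : Type) (r : seq I) (F : I -> M) :
  c p (\sum_(i <- r) F i) = \sum_(i <- r) c p (F i).
Proof. exact: (big_morph (c p) (cDr p) (c0r p)). Qed.

Lemma nabla_powD b u v : nabla_pow b (u + v) = nabla_pow b u + nabla_pow b v.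
Proof.
rewrite /nabla_pow; elim: (enum _) => //= i s ->.
elim: (b i) => //= k ->; exact: nablaD.
Qed.

Lemma nabla_pow0 u : nabla_pow 0%MM u = u.
Proof. by rewrite /nabla_pow; elim: (enum _) => //= i s ->; rewrite mnm0E. Qed.

Lemma iter_nablaC k i j u :
  iter k (nabla j) (nabla i u) = nabla i (iter k (nabla j) u).
Proof. by elim: k => //= k ->; rewrite nablaC. Qed.

Lemma nabla_powS b i u :
  nabla_pow (b + U_(i))%MM u = nabla i (nabla_pow b u).
Proof.
rewrite /nabla_pow.
have Hout s : i \notin s ->
    foldr (fun j v => iter ((b + U_(i))%MM j) (nabla j) v) u s =
    foldr (fun j v => iter (b j) (nabla j) v) u s.
  elim: s => //= j s IHs; rewrite inE negb_or => /andP[ij si].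
  by rewrite IHs // mnmDE mnmE (negbTE ij) addn0.
have iP : i \in enum 'I_n by rewrite mem_enum.
elim: (enum 'I_n) (enum_uniq 'I_n) iP => //= j s IHs /andP[js us].
rewrite inE; have [Eij _ | ij] := eqVneq i j.
  by subst j; rewrite Hout // mnmDE mnm1E eqxx addn1.
by move=> /= si; rewrite IHs // mnmDE mnm1E (negbTE ij) addn0 iter_nablaC.
Qed.

Lemma weyl_actE (d : seq 'X_{1..n}) (P : weyl n K) (u : M) :
    uniq d -> {subset msupp (wpoly P) <= d} ->
  weyl_act P u = \sum_(b <- d) c (wpoly P)@_b (nabla_pow b u).
Proof.
move=> ud sPd; apply: big_supp => //.
by move=> b /memN_msupp_eq0 ->; rewrite c0l.
Qed.

Lemma weyl_actDl (P Q : weyl n K) u :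
  weyl_act (P + Q) u = weyl_act P u + weyl_act Q u.
Proof.
pose d := undup (msupp (wpoly P) ++ msupp (wpoly Q)).
have ud : uniq d by exact: undup_uniq.
rewrite !(@weyl_actE d) //.
- by rewrite -big_split /=; apply: eq_bigr => b _; rewrite mcoeffD cDl.
- by move=> b bQ; rewrite mem_undup mem_cat bQ orbT.
- by move=> b bP; rewrite mem_undup mem_cat bP.
- by move=> b /msuppD_le; rewrite mem_undup.
Qed.

Lemma weyl_act0l u : weyl_act 0 u = 0.
Proof. by apply: (addrI (weyl_act 0 u)); rewrite -weyl_actDl !addr0. Qed.

Lemma weyl_actDr P u v : weyl_act P (u + v) = weyl_act P u + weyl_act P v.
Proof.
rewrite /weyl_act -big_split /=.
by apply: eq_bigr => b _; rewrite nabla_powD cDr.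
Qed.

Lemma weyl_act_dmon b u : weyl_act (wdmon K b) u = nabla_pow b u.
Proof.
rewrite (@weyl_actE [:: b]) //; last by move=> b'; rewrite wpoly_dmon msuppX.
by rewrite big_seq1 wpoly_dmon mcoeffX eqxx c1.
Qed.

Lemma weyl_act_scale (p : {mpoly K[n]}) (P : weyl n K) u :
  weyl_act (wscale p P) u = c p (weyl_act P u).
Proof.
rewrite (@weyl_actE (msupp (wpoly P))) ?msupp_uniq //; last first.
  by rewrite wpoly_scale; apply: msuppZ_le.
rewrite /weyl_act c_sum.
by apply: eq_bigr => b _; rewrite wpoly_scale mcoeffZ cM.
Qed.

End Action.

(* Left multiplication by d_i in normally ordered form:                       *)
(* d_i p(x) d^b = p(x) d_i d^b + (dp/dx_i) d^b.                               *)
HB.lock Definition wnabla (n : nat) (K : fieldType) (i : 'I_n) (P : weyl n K) :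
  weyl n K := Weyl ('X_i * wpoly P + map_mpoly (mderiv i) (wpoly P)).

Section WeylRing.
Variables (n : nat) (K : fieldType).
Implicit Types (p q : {mpoly K[n]}) (P Q S : weyl n K) (i : 'I_n).

Definition wone : weyl n K := Weyl 1.

Lemma wpoly_nabla i P :
  wpoly (wnabla i P) = 'X_i * wpoly P + map_mpoly (mderiv i) (wpoly P).
Proof. by rewrite wnabla.unlock. Qed.

Lemma wnabla_term i p b :
  wnabla i (wscale p (wdmon K b)) =
  wscale p (wdmon K (b + U_(i))) + wscale p^`M(i) (wdmon K b).
Proof.
apply: wpoly_inj; rewrite wpolyD wpoly_nabla !wpoly_scale !wpoly_dmon.
rewrite -scalerAr -mpolyXD addmC; congr (_ + _).
apply/mpolyP => m; rewrite mcoeff_map_mpoly !mcoeffZ mcoeffX.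
by case: (b == m); rewrite /= ?mulr1 ?mulr0 ?raddf0.
Qed.

Lemma wnablaD i P Q : wnabla i (P + Q) = wnabla i P + wnabla i Q.
Proof.
apply: wpoly_inj; rewrite !(wpolyD, wpoly_nabla) mulrDr raddfD /=.
by rewrite addrACA.
Qed.

Lemma wnabla00 i : wnabla i (0 : weyl n K) = 0.
Proof.
by apply: (addrI (wnabla i (0 : weyl n K))); rewrite -wnablaD !addr0.
Qed.

Lemma wnablaM i p P :
  wnabla i (wscale p P) = wscale p^`M(i) P + wscale p (wnabla i P).
Proof.
elim/weyl_ind: P => [|q b P IH].
  by rewrite wnabla00 !wscale0 addr0 wnabla00.
rewrite !(wscaleDr, wnablaD) IH [RHS]addrACA; congr (_ + _).
rewrite -!wscaleM !wnabla_term wscaleDr -!wscaleM mderivM wscaleDl.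
by rewrite addrCA.
Qed.

Lemma wnablaC i j P : wnabla i (wnabla j P) = wnabla j (wnabla i P).
Proof.
elim/weyl_ind: P => [|p b P IH]; first by rewrite !wnabla00.
rewrite 4!wnablaD; congr (_ + _); last exact: IH.
rewrite 2!wnabla_term 2!wnablaD 4!wnabla_term [p^`M(j)^`M(i)]mderiv_comm.
by rewrite -!addmA [(U_(j) + _)%MM]addmC -!addrA; congr (_ + _); rewrite addrCA.
Qed.

End WeylRing.

HB.lock Definition wmul (n : nat) (K : fieldType) (P Q : weyl n K) : weyl n K :=
  weyl_act (@wscale n K) (@wnabla n K) P Q.

Lemma wmulE (n : nat) (K : fieldType) (P Q : weyl n K) :
  wmul P Q = weyl_act (@wscale n K) (@wnabla n K) P Q.
Proof. by rewrite wmul.unlock. Qed.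

Section ActionMul.
Variables (n : nat) (K : fieldType) (M : zmodType).
Variables (c : {mpoly K[n]} -> M -> M) (nabla : 'I_n -> M -> M).
Hypothesis cDr : forall p u v, c p (u + v) = c p u + c p v.
Hypothesis cDl : forall p q u, c (p + q) u = c p u + c q u.
Hypothesis cM : forall p q u, c (p * q) u = c p (c q u).
Hypothesis c1 : forall u, c 1 u = u.
Hypothesis nablaD : forall i u v, nabla i (u + v) = nabla i u + nabla i v.
Hypothesis nablaC :
  forall i j u, nabla i (nabla j u) = nabla j (nabla i u).
Hypothesis nablaM :
  forall i p u, nabla i (c p u) = c p^`M(i) u + c p (nabla i u).

Local Notation act := (weyl_act c nabla).

Lemma weyl_act_nabla i P u : act (wnabla i P) u = nabla i (act P u).
Proof.
elim/weyl_ind: P => [|p b P IH].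
  by rewrite wnabla00 weyl_act0l // (nabla0 nablaD).
rewrite wnablaD wnabla_term !weyl_actDl // nablaD IH; congr (_ + _).
rewrite !weyl_act_scale // !weyl_act_dmon // nablaM addrC.
by rewrite nabla_powS.
Qed.

Lemma weyl_act_mul P Q u : act (wmul P Q) u = act P (act Q u).
Proof.
have actpow b T :
    act (nabla_pow (@wnabla n K) b T) u = nabla_pow nabla b (act T u).
  rewrite /nabla_pow; elim: (enum _) => //= i s <-.
  by elim: (b i) => //= k <-; rewrite weyl_act_nabla.
transitivity (\sum_(b <- msupp (wpoly P))
    act (wscale (wpoly P)@_b (nabla_pow (@wnabla n K) b Q)) u).
  rewrite wmulE; apply: (big_morph (act^~ u)) => [T U|].
    exact: weyl_actDl.
  exact: weyl_act0l.
by apply: eq_bigr => b _; rewrite weyl_act_scale // actpow.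
Qed.

End ActionMul.

Section WeylRingInstance.
Variables (n : nat) (K : fieldType).
Implicit Types (p q : {mpoly K[n]}) (P Q S : weyl n K) (i : 'I_n).

Fact wmulA : associative (@wmul n K).
Proof.
move=> P Q S; rewrite [RHS]wmulE [LHS]wmulE [wmul Q S]wmulE.
apply/esym/weyl_act_mul.
- exact: wscaleDr.
- exact: wscaleDl.
- exact: wscaleM.
- exact: wscale1.
- exact: wnablaD.
- exact: wnablaC.
- exact: wnablaM.
Qed.

Fact wone_dmon : wone n K = wdmon K 0%MM.
Proof. by apply: wpoly_inj; rewrite wpoly_dmon mpolyX0. Qed.

Fact wmul1l : left_id (wone n K) (@wmul n K).
Proof.
move=> P; have -> := wone_dmon.
rewrite wmulE weyl_act_dmon ?nabla_pow0 //; first exact: wscaleDl.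
exact: wscale1.
Qed.

Fact wmul1r : right_id (wone n K) (@wmul n K).
Proof.
have powD b : nabla_pow (@wnabla n K) b (wone n K) = wdmon K b.
  have -> := wone_dmon.
  have step i m : wnabla i (wdmon K m) = wdmon K (m + U_(i)).
    rewrite -[wdmon K m]wscale1 wnabla_term -mpolyC1 mderivC.
    rewrite mpolyC1 wscale1; apply: wpoly_inj.
    by rewrite wpolyD wpoly_scale scale0r addr0.
  have steps k i m : iter k (wnabla i) (wdmon K m) = wdmon K (m + U_(i) *+ k).
    elim: k => [|k /= ->]; first by rewrite mulm0n addm0.
    by rewrite step -addmA mulmSr.
  pose e s := (\sum_(i <- s) U_(i) *+ b i)%MM.
  have fs s : foldr (fun i v => iter (b i) (@wnabla n K i) v) (wdmon K 0%MM) s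
      = wdmon K (e s).
    elim: s => [|i s /= ->]; first by rewrite /e big_nil.
    by rewrite steps /e big_cons addmC.
  rewrite /nabla_pow fs; congr wdmon; rewrite /e [RHS]multinomUE_id.
  by rewrite big_enum.
move=> P; apply: wpoly_inj; rewrite wmulE /weyl_act.
under eq_bigr => b _ do rewrite powD.
rewrite [RHS]mpolyE (big_morph (@wpoly n K) (@wpolyD n K) (wpoly0 n K)).
by apply: eq_bigr => b _; rewrite wpoly_scale wpoly_dmon.
Qed.

Fact wmulDl : left_distributive (@wmul n K) +%R.
Proof. by move=> P Q S; rewrite !wmulE; apply: weyl_actDl; exact: wscaleDl. Qed.

Fact wmulDr : right_distributive (@wmul n K) +%R.
Proof.
move=> P Q S; rewrite !wmulE.
by apply: weyl_actDr; [exact: wscaleDr | exact: wnablaD].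
Qed.

Fact wone_neq0 : wone n K != 0.
Proof. by apply/eqP => /(congr1 (@wpoly n K))/eqP; rewrite wpoly0 oner_eq0. Qed.

HB.instance Definition _ := GRing.Zmodule_isNzRing.Build (weyl n K)
  wmulA wmul1l wmul1r wmulDl wmulDr wone_neq0.

Definition wx p : weyl n K := Weyl p%:MP_[n].
Definition wd i : weyl n K := Weyl 'X_i.

Lemma wscaleE p P : wscale p P = wx p * P.
Proof.
rewrite [RHS]wmulE; have -> : wx p = wscale p (wdmon K 0%MM).
  by apply: wpoly_inj; rewrite wpoly_scale wpoly_dmon mpolyX0 alg_mpolyC.
rewrite weyl_act_scale ?weyl_act_dmon ?nabla_pow0 //; try exact: wscaleDl.
- exact: wscale1.
- exact: wscaleDr.
- exact: wscaleM.
Qed.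

Lemma wdE i P : wd i * P = wnabla i P.
Proof.
rewrite [LHS]wmulE; have -> : wd i = wdmon K (0 + U_(i))%MM.
  by apply: wpoly_inj; rewrite wpoly_dmon add0m.
rewrite weyl_act_dmon; [|exact: wscaleDl|exact: wscale1].
rewrite nabla_powS ?nabla_pow0 //; exact: wnablaC.
Qed.

Lemma wx_scale1 p : wx p = wscale p 1. Proof. by rewrite wscaleE mulr1. Qed.

Lemma wxM p q : wx (p * q) = wx p * wx q.
Proof. by rewrite wx_scale1 wscaleM !wscaleE mulr1. Qed.

Lemma wdx i p : wd i * wx p = wx p * wd i + wx p^`M(i).
Proof.
rewrite wdE {1}wx_scale1 wnablaM addrC -wx_scale1 wscaleE -wdE.
by rewrite mulr1.
Qed.

Lemma wdC i j : wd i * wd j = wd j * wd i.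
Proof.
have E k : wd k = wnabla k 1 by rewrite -wdE mulr1.
by rewrite !wdE (E i) (E j) wnablaC.
Qed.

End WeylRingInstance.

(* D[s] is {poly (weyl n K)}, with s = 'X. *)
Definition dx (n : nat) (K : fieldType) (p : {mpoly K[n]}) :
    {poly (weyl n K)} :=
  (wx p)%:P.

Local Notation "x %:F" := (FracField.tofrac x).

Lemma frac_repr (A : idomainType) (u : {fraction A}) :
  u = (\n_(repr u))%:F / (\d_(repr u))%:F.
Proof.
rewrite -[u in LHS]reprK -[repr u in LHS]Ratio_numden.
case: (repr u) => -[x y] /= y0.
rewrite /GRing.inv /GRing.mul /=; unlock FracField.tofrac.
rewrite -[X in _ = FracField.mul _ X]FracField.pi_inv -[RHS]FracField.pi_mul.
rewrite /FracField.mulf /FracField.invf /=.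
by rewrite !numden_Ratio ?(oner_neq0, mul1r, mulr1).
Qed.

Lemma quotient_rule (A : comNzRingType) (a b c d a' b' c' d' : A) :
    a * d = b * c -> a' * d + a * d' = b' * c + b * c' ->
  (c' * d - c * d') * b ^+ 2 = (a' * b - a * b') * d ^+ 2.
Proof.
move=> e e'.
have -> : (c' * d - c * d') * b ^+ 2 = b * c' * (b * d) - b * c * (b * d').
  by ring.
have -> : b * c' = a' * d + a * d' - b' * c by rewrite e'; ring.
rewrite -e.
have -> : (a' * d + a * d' - b' * c) * (b * d) - a * d * (b * d') =
          a' * b * d ^+ 2 - b' * d * (b * c) by ring.
by rewrite -e; ring.
Qed.

(* Extension of a derivation der of A to fractions, by the quotient rule on a *)
(* representative; fracder_div shows that its choice is irrelevant.           *)
Definition fracder (A : idomainType) (der : A -> A) (u : {fraction A}) :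
    {fraction A} :=
  let a := \n_(repr u) in let b := \d_(repr u) in
  (der a * b - a * der b)%:F / b%:F ^+ 2.

Lemma fracder_div (A : idomainType) (der : A -> A) (a b : A) :
    (forall x y, der (x * y) = der x * y + x * der y) -> b != 0 ->
  fracder der (a%:F / b%:F) = (der a * b - a * der b)%:F / b%:F ^+ 2.
Proof.
move=> derM b0; set u := a%:F / b%:F; rewrite /fracder.
set c := \n_(repr u); set d := \d_(repr u).
have d0 : d != 0 by apply: denom_ratioP.
have bF : b%:F != 0 by rewrite tofrac_eq0.
have dF : d%:F != 0 by rewrite tofrac_eq0.
have E : a * d = b * c.
  apply/eqP; rewrite -tofrac_eq !tofracM [b%:F * _]mulrC -eqr_div //.
  exact/eqP/(frac_repr u).
have E' := congr1 der E; rewrite !derM in E'.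
apply/eqP; rewrite eqr_div ?expf_neq0 //.
by rewrite -!tofracXn -!tofracM tofrac_eq (quotient_rule E E').
Qed.

(* The localization A[1/q], inside the fraction field of A (for q != 0).      *)
Definition localization (A : idomainType) (q : A) (u : {fraction A}) : Prop :=
  exists (p : A) (k : nat), u = p%:F / q%:F ^+ k.

Section Localization.
Variables (A : idomainType) (q : A).
Hypothesis q0 : q != 0.
Local Notation loc := (localization q).

Let qX0 k : q%:F ^+ k != 0. Proof. by rewrite expf_neq0 // tofrac_eq0. Qed.

Lemma loc_emb p : loc p%:F.
Proof. by exists p, 0%N; rewrite expr0 divr1. Qed.

Lemma locD u v : loc u -> loc v -> loc (u + v).
Proof.
move=> [p [k ->]] [p' [l ->]]; exists (p * q ^+ l + p' * q ^+ k), (k + l)%N.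
by rewrite addf_div // exprD tofracD !tofracM !tofracXn.
Qed.

Lemma locM u v : loc u -> loc v -> loc (u * v).
Proof.
move=> [p [k ->]] [p' [l ->]]; exists (p * p'), (k + l)%N.
by rewrite mulf_div exprD tofracM.
Qed.

Lemma locX u k : loc u -> loc (u ^+ k).
Proof.
move=> lu; elim: k => [|k IH]; last by rewrite exprS; apply: locM.
by rewrite expr0 -tofrac1; apply: loc_emb.
Qed.

Lemma locN u : loc u -> loc (- u).
Proof. by move=> [p [k ->]]; exists (- p), k; rewrite tofracN mulNr. Qed.

Lemma loc_sum (I : Type) (r : seq I) (G : I -> {fraction A}) :
  (forall i, loc (G i)) -> loc (\sum_(i <- r) G i).
Proof.
move=> lG; elim: r => [|i r IH].
  by rewrite big_nil -tofrac0; apply: loc_emb.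
by rewrite big_cons; apply: locD.
Qed.

Lemma locV a b : a * b = q -> loc (a%:F)^-1.
Proof.
move=> E; exists b, 1%N; rewrite expr1 -E tofracM.
have : a * b != 0 by rewrite E.
rewrite mulf_eq0 negb_or => /andP[a0 b0].
by rewrite invfM mulrC mulfVK ?tofrac_eq0.
Qed.

Lemma loc_der (der : A -> A) u :
    (forall x y, der (x * y) = der x * y + x * der y) ->
  loc u -> loc (fracder der u).
Proof.
move=> derM [p [k ->]]; rewrite -tofracXn fracder_div ?expf_neq0 //.
by rewrite -!tofracXn -exprM tofracXn; eexists; eexists.
Qed.

End Localization.

Section TwistedModule.
Variables (n : nat) (K : fieldType).

(* K(x,s) *)
Local Notation F := {fraction {poly {mpoly K[n]}}}.
Local Notation D := {poly (weyl n K)}.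

Definition fracx (p : {mpoly K[n]}) : F := (p%:P)%:F.
Definition fracs : F := ('X)%:F.

(* d/dx_i on K(x,s) *)
Definition fracderiv (i : 'I_n) : F -> F := fracder (map_poly (mderiv i)).

Lemma map_mderivM i (a b : {poly {mpoly K[n]}}) :
  map_poly (mderiv i) (a * b) =
  map_poly (mderiv i) a * b + a * map_poly (mderiv i) b.
Proof.
apply/polyP => k; rewrite coefD coef_map !coefM raddf_sum -big_split /=.
by apply: eq_bigr => j _; rewrite mderivM !coef_map.
Qed.

(* The element u (f/g)^s of the free module of rank one is represented by u.  *)
(* For f g != 0, K[x,s,1/(fg)] is the subring fgloc of K(x,s); all the        *)
(* elements to which D[s] is applied below lie in it, and it is stable under  *)
(* the action (fgvec_loc and dsact_loc).                                      *)
Definition conn (f g : {mpoly K[n]}) (i : 'I_n) (u : F) : F :=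
  fracderiv i u + fracs * u * (fracx f^`M(i) / fracx f)
                - fracs * u * (fracx g^`M(i) / fracx g).

Definition dsact (f g : {mpoly K[n]}) (h : D) (u : F) : F :=
  \sum_(i < size h)
    fracs ^+ i * weyl_act (fun p v => fracx p * v) (conn f g) h`_i u.

(* 1/g^m (f/g)^(s+k), with (f/g)^(s+k) = (f^k/g^k) (f/g)^s *)
Definition fgvec (f g : {mpoly K[n]}) (m k : nat) : F :=
  (fracx g ^+ m)^-1 * (fracx f ^+ k / fracx g ^+ k).

Definition fgloc (f g : {mpoly K[n]}) : F -> Prop :=
  localization ((f * g)%:P : {poly {mpoly K[n]}}).

Lemma fgvec_loc f g m k : f * g != 0 -> fgloc f g (fgvec f g m k).
Proof.
move=> fg0; have q0 : ((f * g)%:P : {poly {mpoly K[n]}}) != 0.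
  by rewrite polyC_eq0.
have gV : fgloc f g (fracx g)^-1.
  by apply: (locV q0 (b := f%:P)); rewrite -polyCM mulrC.
rewrite /fgvec -!exprVn; apply: locM => //; first exact: locX.
by apply: locM => //; apply: locX => //; apply: loc_emb.
Qed.

Lemma conn_loc f g i u :
  f * g != 0 -> fgloc f g u -> fgloc f g (conn f g i u).
Proof.
move=> fg0 lu; have q0 : ((f * g)%:P : {poly {mpoly K[n]}}) != 0.
  by rewrite polyC_eq0.
have gV : fgloc f g (fracx g)^-1.
  by apply: (locV q0 (b := f%:P)); rewrite -polyCM mulrC.
have fV : fgloc f g (fracx f)^-1.
  by apply: (locV q0 (b := g%:P)); rewrite -polyCM.
have ls p v : fgloc f g v -> fgloc f g (fracs * u * (fracx p * v)).
  move=> lv; apply: locM => //; apply: locM => //; exact: loc_emb.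
rewrite /conn; apply: locD => //; last by apply: locN; apply: ls.
apply: locD => //; last exact: ls.
by apply: loc_der => //; apply: map_mderivM.
Qed.

Lemma dsact_loc f g h u :
  f * g != 0 -> fgloc f g u -> fgloc f g (dsact f g h u).
Proof.
move=> fg0 lu; have q0 : ((f * g)%:P : {poly {mpoly K[n]}}) != 0.
  by rewrite polyC_eq0.
rewrite /dsact; apply: loc_sum => // i; apply: locM => //.
  by apply: locX => //; apply: loc_emb.
rewrite /weyl_act; apply: loc_sum => // b; apply: locM => //.
  exact: loc_emb.
rewrite /nabla_pow; elim: (enum _) => //= j s.
by elim: (b j) => //= k IH lk; apply: conn_loc => //; apply: IH.
Qed.

Definition ann (f g : {mpoly K[n]}) (k : nat) (h : D) : Prop :=
  dsact f g h (fgvec f g k 0) = 0.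

Definition bernstein_ideal (f g : {mpoly K[n]}) (m N : nat) (b : {poly K}) :
    Prop :=
  exists P : nat -> D,
    (map_poly (@mpolyC n K) b)%:F * fgvec f g m 0 =
    \sum_(1 <= k < N.+1) dsact f g (P k) (fgvec f g m k).

(* The monic generator of the ideal, or 0 if the ideal is zero; it exists and *)
(* is unique because K[s] is principal.                                       *)
Definition bernstein_poly (f g : {mpoly K[n]}) (m N : nat) : {poly K} :=
  epsilon (inhabits 0) (fun b : {poly K} =>
    (b \is monic \/ b = 0) /\
    forall c : {poly K}, bernstein_ideal f g m N c <-> b %| c).

(* I_(m+N)(s) + D[s]<f g^(N-1), ..., f^N> *)
Definition J_ideal (f g : {mpoly K[n]}) (m N : nat) (h : D) : Prop :=
  exists (h0 : D) (Q : nat -> D), ann f g (m + N) h0 /\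
    h = h0 + \sum_(1 <= k < N.+1) Q k * dx (f ^+ k * g ^+ (N - k)).

End TwistedModule.

Section Groebner.
Variables (n : nat) (K : fieldType).
Local Notation D := {poly (weyl n K)}.

(* (i, a, b) stands for the monomial s^i x^a d^b; products and divisibility   *)
(* are those of the exponents.                                                *)
Definition dsmon : Type := (nat * 'X_{1..n} * 'X_{1..n})%type.

Definition dsmon_mul (u v : dsmon) : dsmon :=
  let: (i, a, b) := u in let: (j, c, d) := v in
  ((i + j)%N, (a + c)%MM, (b + d)%MM).

Definition dsmon_div (u v : dsmon) : bool :=
  let: (i, a, b) := u in let: (j, c, d) := v in
  [&& (i <= j)%N, (a <= c)%MM & (b <= d)%MM].

Definition dscoef (h : D) (u : dsmon) : K :=
  let: (i, a, b) := u in ((wpoly h`_i)@_b)@_a.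

Record monomial_well_order (lt : rel dsmon) : Prop := {
  mwo_irr : irreflexive lt;
  mwo_trans : transitive lt;
  mwo_total : forall u v, u != v -> lt u v || lt v u;
  mwo_mul : forall u v w, lt u v -> lt (dsmon_mul u w) (dsmon_mul v w);
  mwo_wf : well_founded lt
}.

Definition leading (lt : rel dsmon) (h : D) (u : dsmon) : Prop :=
  dscoef h u != 0 /\ forall v, dscoef h v != 0 -> v != u -> lt v u.

(* G is contained in J and its leading monomials generate the monomial ideal  *)
(* of the leading monomials of J; G may contain 0.                            *)
Definition groebner (lt : rel dsmon) (J : D -> Prop) (G : seq D) : Prop :=
  (forall h, h \in G -> J h) /\
  forall h u, J h -> leading lt h u ->
    exists h' u', [/\ h' \in G, leading lt h' u' & dsmon_div u' u].

(* The element of h + J none of whose monomials is divisible by a leading     *)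
(* monomial of G; it exists and is unique when lt is a monomial well-order    *)
(* and G is a Groebner basis of the left ideal J.                             *)
Definition normal_form (lt : rel dsmon) (J : D -> Prop) (G : seq D) (h : D) :
    D :=
  epsilon (inhabits 0) (fun r : D => J (r - h) /\
    forall v, dscoef r v != 0 ->
    forall h' u', h' \in G -> leading lt h' u' -> ~~ dsmon_div u' v).

(* a_0 P_0 + ... + a_k P_k = 0 with a_k = 1; only a_0 ... a_k are relevant.   *)
Definition monic_relation (P : nat -> D) (k : nat) (a : nat -> K) : Prop :=
  a k = 1 /\ \sum_(i < k.+1) dx (a i)%:MP_[n] * P i = 0.

End Groebner.

(* Main.v *)
Require Import Defs.
From mathcomp Require Import all_boot all_order all_algebra.
From mathcomp Require Import mpoly complex.
From mathcomp Require Import reals ring.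
From Stdlib Require Import ClassicalEpsilon Classical.
Import GRing.Theory.
Local Open Scope ring_scope.

(* With v = 1/g^(m+N) (f/g)^s one has 1/g^m (f/g)^s = g^N v and               *)
(* 1/g^m (f/g)^(s+k) = f^k g^(N-k) v, so that b belongs to the Bernstein      *)
(* ideal iff b(s) g^N lies in J = Ann(v) + D[s]<f^k g^(N-k)>_k. Taking normal *)
(* forms is linear with kernel J; hence a_0 P_0 + ... + a_k P_k = 0 iff the   *)
(* generator of the Bernstein ideal divides a_0 + ... + a_k s^k, and the      *)
(* shortest monic relation gives the generator itself.                        *)

Set Implicit Arguments.
Unset Strict Implicit.
Unset Printing Implicit Defensive.

(** Passing between the Bernstein ideal and [J] requires that D[s] really acts. The operators d_i +
    s d_i log(f/g) commute because logarithmic derivatives form a closed form ([tconnC]); this gives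
    the module law [tactM], and cancelling powers of [g] ([tact_gen]) gives the equivalence
    [tbernsteinP].

    On the side of the Gröbner basis, division along the well-order produces a reduced element in
    every coset of [J] ([normal_form_exists]), and the only reduced element of [J] is 0
    ([reduced_ideal]). Reduced elements are closed under linear combinations, so the sum of the a_i
    P_i is the reduced representative of a(s) g^N; it vanishes iff a(s) lies in the Bernstein ideal
    ([normal_form_relation]).

    That ideal is principal. The coefficients of its nonzero monic generator b are a monic relation
    with k = deg b, whence termination ([monic_relation_bernstein]). A shortest monic relation is a
    monic multiple of b of degree at most deg b, hence b itself
    ([bernstein_poly_least_relation]). *)

Local Notation "x %:F" := (FracField.tofrac x).

(** * Derivations on fields of fractions *)

Section QuotientRules.
Variable F : fieldType.
Implicit Types a b c d : F.

Lemma quotient_ruleD a b c d a' b' c' d' : b != 0 -> d != 0 ->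
  ((a' * d + a * d' + (c' * b + c * b')) * (b * d)
     - (a * d + c * b) * (b' * d + b * d')) / (b * d) ^+ 2
  = (a' * b - a * b') / b ^+ 2 + (c' * d - c * d') / d ^+ 2.
Proof. by move=> b0 d0; field; rewrite b0 d0. Qed.

Lemma quotient_ruleM a b c d a' b' c' d' : b != 0 -> d != 0 ->
  ((a' * c + a * c') * (b * d) - a * c * (b' * d + b * d')) / (b * d) ^+ 2
  = (a' * b - a * b') / b ^+ 2 * (c / d)
    + a / b * ((c' * d - c * d') / d ^+ 2).
Proof. by move=> b0 d0; field; rewrite b0 d0. Qed.

(** Indices record the derivations applied, [a12] being the mixed derivative. The two sides are the
    quotient rule iterated in the two orders. *)
Lemma quotient_ruleC a b a1 a2 a12 b1 b2 b12 : b != 0 ->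
  ((a12 * b + a2 * b1 - (a1 * b2 + a * b12)) * (b * b)
     - (a2 * b - a * b2) * (b1 * b + b * b1)) / (b * b) ^+ 2
  = ((a12 * b + a1 * b2 - (a2 * b1 + a * b12)) * (b * b)
     - (a1 * b - a * b1) * (b2 * b + b * b2)) / (b * b) ^+ 2.
Proof. by move=> b0; field. Qed.

End QuotientRules.

Section FractionDerivation.
Variables (A : idomainType) (der : {additive A -> A}).
Hypothesis derM : forall x y, der (x * y) = der x * y + x * der y.
Implicit Types (a b : A) (u v : {fraction A}).

(** Replaces the representative chosen by [repr] with an arbitrary quotient, on which [fracder_div]
    computes. *)
Lemma fraction_ind (T : {fraction A} -> Prop) :
  (forall a b, b != 0 -> T (a%:F / b%:F)) -> forall u, T u.
Proof. by move=> Tab u; rewrite (frac_repr u); apply/Tab/denom_ratioP. Qed.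

Lemma fracderD u v : fracder der (u + v) = fracder der u + fracder der v.
Proof.
elim/fraction_ind: u => a b b0; elim/fraction_ind: v => c d d0.
have b0F : b%:F != 0 by rewrite tofrac_eq0.
have d0F : d%:F != 0 by rewrite tofrac_eq0.
rewrite addf_div // -!tofracM -tofracD !fracder_div ?mulf_neq0 //.
rewrite !derM [der (_ + _)]raddfD /= !derM !(tofracD, tofracM, tofracN).
exact: quotient_ruleD.
Qed.

Lemma fracderM u v :
  fracder der (u * v) = fracder der u * v + u * fracder der v.
Proof.
elim/fraction_ind: u => a b b0; elim/fraction_ind: v => c d d0.
have b0F : b%:F != 0 by rewrite tofrac_eq0.
have d0F : d%:F != 0 by rewrite tofrac_eq0.
rewrite mulf_div -!tofracM !fracder_div ?mulf_neq0 //.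
rewrite !derM !(tofracD, tofracM, tofracN).
exact: quotient_ruleM.
Qed.

Lemma fracder_tofrac a : fracder der a%:F = (der a)%:F.
Proof.
have der1 : der 1 = 0.
  by apply: (addrI (der 1)); rewrite addr0 -{3}[1]mulr1 derM mulr1 mul1r.
rewrite -[in LHS](divr1 a%:F) -tofrac1 fracder_div ?oner_neq0 //.
by rewrite der1 mulr0 subr0 mulr1 tofrac1 expr1n divr1.
Qed.

End FractionDerivation.

Lemma fracderC (A : idomainType) (der1 der2 : {additive A -> A}) u :
    (forall x y, der1 (x * y) = der1 x * y + x * der1 y) ->
    (forall x y, der2 (x * y) = der2 x * y + x * der2 y) ->
    (forall x, der1 (der2 x) = der2 (der1 x)) ->
  fracder der1 (fracder der2 u) = fracder der2 (fracder der1 u).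
Proof.
move=> M1 M2 C; elim/fraction_ind: u => a b b0.
have b0F : b%:F != 0 by rewrite tofrac_eq0.
rewrite !fracder_div // -!tofracXn !fracder_div ?expf_neq0 //.
rewrite !(expr2, M1, M2, raddfB) /= !(M1, M2, C) !(tofracD, tofracM, tofracN).
exact: quotient_ruleC.
Qed.

(** * The twisted module *)

(* F stands for K(x,s), with fx the inclusion of K[x] and der i = d/dx_i;     *)
(* tconn, tact, tvec, tideal and tbernstein are the abstract counterparts of  *)
(* conn, dsact, fgvec, J_ideal and bernstein_ideal.                           *)
Section TwistedAction.
Variables (n : nat) (K F : fieldType) (fx : {rmorphism {mpoly K[n]} -> F}).
Variables (s : F) (der : 'I_n -> F -> F) (f g : {mpoly K[n]}).
Local Notation D := {poly (weyl n K)}.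
Implicit Types (u v : F) (i j : 'I_n) (p q : {mpoly K[n]}) (h : D).
Hypothesis derD : forall i u v, der i (u + v) = der i u + der i v.
Hypothesis derM : forall i u v, der i (u * v) = der i u * v + u * der i v.
Hypothesis derC : forall i j u, der i (der j u) = der j (der i u).
Hypothesis der_fx : forall i p, der i (fx p) = fx p^`M(i).
Hypothesis der_s : forall i, der i s = 0.
Hypotheses (f0 : fx f != 0) (g0 : fx g != 0).

Definition tconn i u : F :=
  der i u + s * u * (fx f^`M(i) / fx f) - s * u * (fx g^`M(i) / fx g).

Local Notation act := (weyl_act (fun p v => fx p * v) tconn).

Definition tact h u : F := \sum_(i < size h) s ^+ i * act h`_i u.

(** The logarithmic derivative of f/g, so that [tconn i] is d_i + s [dlog i]. *)
Let dlog i : F := fx f^`M(i) / fx f - fx g^`M(i) / fx g.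

Let tconnE i u : tconn i u = der i u + s * u * dlog i.
Proof. by rewrite /tconn /dlog mulrBr addrA. Qed.

(** With subscripts for partial derivatives, both sides equal (p p_ij - p_i p_j)/p^2. *)
Let der_logder i j p : fx p != 0 ->
  der i (fx p^`M(j) / fx p) = der j (fx p^`M(i) / fx p).
Proof.
move=> p0.
have e k q : der k (fx q / fx p) =
    (fx q^`M(k) * fx p - fx q * fx p^`M(k)) / fx p ^+ 2.
  have : der k (fx q / fx p * fx p) = fx q^`M(k) by rewrite mulfVK.
  by rewrite derM der_fx => <-; field.
by rewrite !e mderiv_comm [fx p^`M(j) * _]mulrC.
Qed.

Let derN i u : der i (- u) = - der i u.
Proof.
apply: (addrI (der i u)); rewrite -derD !subrr.
by apply: (addrI (der i 0)); rewrite -derD !addr0.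
Qed.

Let der_dlog i j : der i (dlog j) = der j (dlog i).
Proof. by rewrite !derD !derN !(der_logder i j). Qed.

Let tconnD i u v : tconn i (u + v) = tconn i u + tconn i v.
Proof. by rewrite !tconnE derD; ring. Qed.

(** Flatness: the commutator is multiplication by s (d_i [dlog j] - d_j [dlog i]), which is 0 by
    [der_dlog]. *)
Let tconnC i j u : tconn i (tconn j u) = tconn j (tconn i u).
Proof.
rewrite !tconnE !derD !derM !der_s derC.
by rewrite (der_dlog i j); ring.
Qed.

Let tconnM i p u :
  tconn i (fx p * u) = fx p^`M(i) * u + fx p * tconn i u.
Proof. by rewrite !tconnE derM der_fx; ring. Qed.

Let tconnMs i u : tconn i (s * u) = s * tconn i u.
Proof. by rewrite !tconnE derM der_s; ring. Qed.

Let cDr p u v : fx p * (u + v) = fx p * u + fx p * v.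
Proof. exact: mulrDr. Qed.
Let cDl p q u : fx (p + q) * u = fx p * u + fx q * u.
Proof. by rewrite rmorphD mulrDl. Qed.
Let cM p q u : fx (p * q) * u = fx p * (fx q * u).
Proof. by rewrite rmorphM mulrA. Qed.
Let c1 u : fx 1 * u = u. Proof. by rewrite rmorph1 mul1r. Qed.

Lemma act_mul (P Q : weyl n K) u : act (P * Q) u = act P (act Q u).
Proof. exact: (weyl_act_mul cDr cDl cM c1 tconnD tconnC tconnM). Qed.

Lemma actDl (P Q : weyl n K) u : act (P + Q) u = act P u + act Q u.
Proof. exact: weyl_actDl. Qed.

Lemma actDr (P : weyl n K) u v : act P (u + v) = act P u + act P v.
Proof. exact: (weyl_actDr cDr tconnD). Qed.

Lemma act0 u : act 0 u = 0.
Proof. exact: weyl_act0l. Qed.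

Lemma act_x p u : act (wx p) u = fx p * u.
Proof.
rewrite wx_scale1 (_ : 1 = wdmon K 0%MM); last exact: wone_dmon.
by rewrite (weyl_act_scale _ cDr cDl cM) (weyl_act_dmon _ cDl c1) nabla_pow0.
Qed.

Lemma actMs (P : weyl n K) u : act P (s * u) = s * act P u.
Proof.
rewrite /weyl_act mulr_sumr; apply: eq_bigr => b _.
rewrite mulrCA; congr (_ * _); rewrite /nabla_pow.
elim: (enum _) => //= i r ->; elim: (b i) => //= k ->; exact: tconnMs.
Qed.

Lemma tactE h u k : (size h <= k)%N ->
  tact h u = \sum_(i < k) s ^+ i * act h`_i u.
Proof.
move=> hk; rewrite /tact (big_ord_widen k (fun e => s ^+ e * act h`_e u)) //.
rewrite big_mkcond; apply: eq_bigr => e _; case: ltnP => // he.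
by rewrite nth_default // act0 mulr0.
Qed.

Lemma tactDl h h' u : tact (h + h') u = tact h u + tact h' u.
Proof.
rewrite !(@tactE _ _ (maxn (size h) (size h'))) ?size_polyD ?leq_max ?leqnn
  ?orbT //.
by rewrite -big_split; apply: eq_bigr => i _; rewrite coefD actDl mulrDr.
Qed.

Lemma tactDr h u v : tact h (u + v) = tact h u + tact h v.
Proof.
by rewrite -big_split; apply: eq_bigr => i _; rewrite /= actDr mulrDr.
Qed.

Lemma tact0l u : tact 0 u = 0.
Proof. by apply: (addrI (tact 0 u)); rewrite -tactDl !addr0. Qed.

Lemma tact0r h : tact h 0 = 0.
Proof. by apply: (addrI (tact h 0)); rewrite -tactDr !addr0. Qed.

Lemma tactNl h u : tact (- h) u = - tact h u.
Proof. by apply: (addrI (tact h u)); rewrite -tactDl !subrr tact0l. Qed.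

Lemma tact_suml (I : Type) (r : seq I) (H : I -> D) u :
  tact (\sum_(i <- r) H i) u = \sum_(i <- r) tact (H i) u.
Proof.
exact: (big_morph (tact^~ u) (fun h h' => tactDl h h' u) (tact0l u)).
Qed.

Lemma tactC (P : weyl n K) u : tact P%:P u = act P u.
Proof.
by rewrite (@tactE _ _ 1) ?size_polyC_leq1 // big_ord1 coefC eqxx mul1r.
Qed.

Lemma tact_x p u : tact (dx p) u = fx p * u.
Proof. by rewrite tactC act_x. Qed.

Lemma tactMX h u : tact (h * 'X) u = s * tact h u.
Proof.
rewrite (@tactE _ _ (size h).+1); last first.
  have [->|h0] := eqVneq h 0; first by rewrite mul0r size_poly0.
  by rewrite size_mulX.
rewrite big_ord_recl coefMX /= act0 mulr0 add0r [tact h u]/tact mulr_sumr.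
by apply: eq_bigr => i _; rewrite coefMX /= exprS mulrA.
Qed.

Lemma tactCM (P : weyl n K) h u : tact (P%:P * h) u = act P (tact h u).
Proof.
elim/poly_ind: h => [|h Q IH].
  by rewrite mulr0 tact0l -tactC tact0r.
rewrite mulrDr mulrA !tactDl !tactMX IH actDr actMs -polyCM !tactC.
by rewrite act_mul.
Qed.

Lemma tactM h h' u : tact (h * h') u = tact h (tact h' u).
Proof.
elim/poly_ind: h => [|h P IH]; first by rewrite mul0r !tact0l.
rewrite mulrDl -mulrA -commr_polyX mulrA !tactDl !tactMX IH tactCM.
by rewrite tactC.
Qed.

Variable ev : {rmorphism {poly {mpoly K[n]}} -> F}.
Hypotheses (evC : forall p, ev p%:P = fx p) (evX : ev 'X = s).

Definition tvec (k l : nat) : F := (fx g ^+ k)^-1 * (fx f ^+ l / fx g ^+ l).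

Definition tideal (m N : nat) h : Prop :=
  exists (h0 : D) (Q : nat -> D), tact h0 (tvec (m + N) 0) = 0 /\
    h = h0 + \sum_(1 <= k < N.+1) Q k * dx (f ^+ k * g ^+ (N - k)).

Definition tbernstein (m N : nat) (b : {poly K}) : Prop :=
  exists P : nat -> D, ev (map_poly (@mpolyC n K) b) * tvec m 0 =
    \sum_(1 <= k < N.+1) tact (P k) (tvec m k).

(** The operator b(s) acts as multiplication by b(s). The bound [k] is free so that the sum can be
    indexed by the length of a relation instead of [size b]. *)
Lemma tact_spoly (b : {poly K}) k u : (size b <= k)%N ->
  tact (\sum_(i < k) dx (b`_i)%:MP_[n] * 'X^i) u =
  ev (map_poly (@mpolyC n K) b) * u.
Proof.
move=> hb; have -> :
    map_poly (@mpolyC n K) b = \sum_(i < k) (b`_i)%:MP%:P * 'X^i.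
  rewrite -[in LHS](coefK b); apply/polyP => e.
  rewrite coef_map coef_poly coef_sum.
  under eq_bigr => i _ do rewrite coefCM coefXn.
  have [ek|ke] := ltnP e k; last first.
    rewrite ltnNge (leq_trans hb ke) /= raddf0 big1 // => i _.
    by rewrite gtn_eqF ?mulr0 // (leq_trans (ltn_ord i)).
  rewrite (bigD1 (Ordinal ek)) //= eqxx mulr1 big1 ?addr0 => [|i /negbTE ie].
    by case: ltnP => // /(nth_default 0) ->.
  by rewrite (_ : (e == i) = false) ?mulr0 // eq_sym.
rewrite tact_suml rmorph_sum mulr_suml; apply: eq_bigr => i _.
rewrite tactM tact_x rmorphM rmorphXn /= evC evX -mulrA; congr (_ * _).
elim: (nat_of_ord i) => [|e IH]; last first.
  by rewrite exprSr tactMX IH exprS mulrA.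
rewrite !expr0 -[1 in LHS]/(1%:P) tactC mul1r.
have -> : 1 = wx 1 :> weyl n K by rewrite wx_scale1 wscale1.
by rewrite act_x rmorph1 mul1r.
Qed.

(** Clearing denominators: f^k g^(N-k) / g^(m+N) = f^k / g^(m+k), where [k <= N] makes the truncated
    subtraction exact. *)
Lemma tact_gen m N k : (k <= N)%N ->
  tact (dx (f ^+ k * g ^+ (N - k))) (tvec (m + N) 0) = tvec m k.
Proof.
move=> kN; rewrite tact_x rmorphM !rmorphXn /= /tvec.
rewrite -{2}(subnK kN) !exprD !expr0.
have := expf_neq0 m g0; have := expf_neq0 (N - k) g0; have := expf_neq0 k g0.
(* The powers of g become atoms, leaving a plain rational identity for [field]. *)
move: (fx g ^+ k) (fx g ^+ (N - k)) (fx g ^+ m) => x y z x0 y0 z0.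
by field; rewrite x0 y0 z0 oner_eq0.
Qed.

(** Evaluating operators at v = [tvec (m + N) 0] has kernel Ann(v). Hence h lies in [tideal] iff h v
    is a combination of the [tvec m k], 1 <= k <= N; here h = b(s) g^N. *)
Lemma tbernsteinP m N (b : {poly K}) k : (size b <= k)%N ->
  tbernstein m N b <->
  tideal m N (\sum_(i < k) dx (b`_i)%:MP_[n] * ('X^i * dx (g ^+ N))).
Proof.
move=> hb; under eq_bigr => i _ do rewrite mulrA.
rewrite -mulr_suml; set B := \sum_(i < k) _.
have gN : tact (dx (g ^+ N)) (tvec (m + N) 0) = tvec m 0.
  by have := @tact_gen m N 0 (leq0n N); rewrite expr0 mul1r subn0.
have sumE Q : tact (\sum_(1 <= k < N.+1) Q k * dx (f ^+ k * g ^+ (N - k)))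
    (tvec (m + N) 0) = \sum_(1 <= k < N.+1) tact (Q k) (tvec m k).
  rewrite tact_suml; apply: eq_big_nat => e /andP[_ eN].
  by rewrite tactM tact_gen.
have BE : tact (B * dx (g ^+ N)) (tvec (m + N) 0) =
    ev (map_poly (@mpolyC n K) b) * tvec m 0.
  by rewrite tactM gN tact_spoly.
split=> [[P e]|[h0 [Q [a0 e]]]].
  (* The difference of the two operators kills v, by the Bernstein identity [e]. *)
  exists (B * dx (g ^+ N) -
    \sum_(1 <= k < N.+1) P k * dx (f ^+ k * g ^+ (N - k))).
  exists P; split; last by rewrite subrK.
  by rewrite tactDl tactNl sumE BE e subrr.
by exists Q; rewrite -BE e tactDl a0 add0r sumE.
Qed.

Lemma tidealD m N h h' : tideal m N h -> tideal m N h' -> tideal m N (h + h').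
Proof.
move=> [h0 [Q [a0 ->]]] [h1 [Q' [a1 ->]]].
exists (h0 + h1), (fun k => Q k + Q' k); rewrite tactDl a0 a1 addr0; split=> //.
rewrite addrACA -big_split /=; congr (_ + _).
by apply: eq_bigr => k _; rewrite mulrDl.
Qed.

Lemma tidealM m N h h' : tideal m N h' -> tideal m N (h * h').
Proof.
move=> [h0 [Q [a0 ->]]]; exists (h * h0), (fun k => h * Q k).
rewrite tactM a0 tact0r mulrDr mulr_sumr; split=> //; congr (_ + _).
by apply: eq_bigr => k _; rewrite mulrA.
Qed.

Lemma tideal0 m N : tideal m N 0.
Proof.
exists 0, (fun=> 0); rewrite tact0l; split=> //.
by rewrite big1 ?addr0 // => k _; rewrite mul0r.
Qed.

Lemma tbernstein0 m N : tbernstein m N 0.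
Proof.
exists (fun=> 0); rewrite !rmorph0 mul0r big1 // => k _.
exact: tact0l.
Qed.

Lemma tbernsteinD m N b c :
  tbernstein m N b -> tbernstein m N c -> tbernstein m N (b + c).
Proof.
move=> [P eP] [Q eQ]; exists (fun k => P k + Q k).
rewrite !rmorphD /= mulrDl eP eQ -big_split /=.
by apply: eq_bigr => k _; rewrite tactDl.
Qed.

Lemma tbernsteinM m N b c : tbernstein m N c -> tbernstein m N (b * c).
Proof.
move=> [P eP]; pose B : D := \sum_(i < size b) dx (b`_i)%:MP_[n] * 'X^i.
exists (fun k => B * P k); rewrite !rmorphM /= -mulrA eP mulr_sumr.
by apply: eq_bigr => k _; rewrite tactM tact_spoly.
Qed.

End TwistedAction.

(** * Monomials and coefficients in D[s] *)

Lemma mnm_addm_ind (n : nat) (T : 'X_{1..n} -> Prop) (a c : 'X_{1..n}) :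
    (forall b i, T b -> T (b + U_(i))%MM) -> (a <= c)%MM -> T a -> T c.
Proof.
move=> TS ac; rewrite -(submK ac) addmC; move: (c - a)%MM => {c ac} m.
pose S m := forall b : 'X_{1..n}, T b -> T (b + m)%MM.
apply: (_ : S m); rewrite [m]multinomUE_id.
apply: (big_ind S) => [b | u v Su Sv b | i _ b]; first by rewrite addm0.
  by move=> /Su /Sv; rewrite addmA.
elim: (m i) => [|k IH] in b *; first by rewrite mulm0n addm0.
by move=> /IH /(TS _ i); rewrite mulmSr addmA.
Qed.

Lemma mcoeffMX_neq0 (n : nat) (A : nzRingType) (p : {mpoly A[n]}) m k :
  (p * 'X_[m])@_k != 0 -> exists2 k', k = (m + k')%MM & p@_k' != 0.
Proof.
rewrite -mcoeff_msupp (perm_mem (msuppMX p m)) => /mapP[k' k'p ->].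
by exists k'; rewrite // -mcoeff_msupp.
Qed.

Section Coefficients.
Variables (n : nat) (K : fieldType).
Local Notation D := {poly (weyl n K)}.
Implicit Types (h : D) (u v w : dsmon n).

Definition dsmon1 : dsmon n := (0%N, 0%MM, 0%MM).

Lemma dsmon_mulC u v : dsmon_mul u v = dsmon_mul v u.
Proof.
by case: u v => [[i a] b] [[j c] d]; rewrite /= addnC addmC [(b + d)%MM]addmC.
Qed.

Lemma dsmon_mul1 u : dsmon_mul u dsmon1 = u.
Proof. by case: u => [[i a] b] /=; rewrite addn0 !addm0. Qed.

Lemma dscoef0 u : dscoef (0 : D) u = 0.
Proof. by case: u => [[i a] b] /=; rewrite coef0 wpoly0 !mcoeff0. Qed.

Lemma dscoefD h h' u : dscoef (h + h') u = dscoef h u + dscoef h' u.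
Proof. by case: u => [[i a] b] /=; rewrite coefD wpolyD !mcoeffD. Qed.

Lemma dscoefN h u : dscoef (- h) u = - dscoef h u.
Proof. by apply: (addrI (dscoef h u)); rewrite -dscoefD !subrr dscoef0. Qed.

Lemma dscoefB h h' u : dscoef (h - h') u = dscoef h u - dscoef h' u.
Proof. by rewrite dscoefD dscoefN. Qed.

Lemma dscoefCM (c : K) h u : dscoef (dx c%:MP_[n] * h) u = c * dscoef h u.
Proof.
case: u => [[i a] b] /=.
by rewrite coefCM -wscaleE wpoly_scale mcoeffZ mcoeffCM.
Qed.

Lemma dscoef_eq0 h : (forall u, dscoef h u = 0) -> h = 0.
Proof.
move=> h0; apply/polyP => i; apply: wpoly_inj; rewrite coef0 wpoly0.
apply/mpolyP => b; rewrite mcoeff0; apply/mpolyP => a; rewrite mcoeff0.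
exact: (h0 (i, a, b)).
Qed.

Lemma dscoef_supp h : exists s : seq (dsmon n),
  forall u, dscoef h u != 0 -> u \in s.
Proof.
exists [seq (x.1, a, x.2) | x <- [seq (i, b) | i <- iota 0 (size h),
   b <- msupp (wpoly h`_i)], a <- msupp (wpoly h`_(x.1))@_(x.2)].
move=> [[i a] b] /= hu.
apply/allpairsPdep; exists (i, b), a; split=> //; last first.
  by rewrite mcoeff_msupp.
apply/allpairsPdep; exists i, b; split=> //; last first.
  by rewrite mcoeff_msupp; apply: contraNneq hu => ->; rewrite mcoeff0.
rewrite mem_iota /=; apply: contraNT hu; rewrite -leqNgt => hi.
by rewrite nth_default // wpoly0 !mcoeff0.
Qed.

Definition dsmonom (c : K) (u : dsmon n) : D :=
  let: (i, a, b) := u in (wscale (c *: 'X_[a]) (wdmon K b))%:P * 'X^i.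

Lemma dscoef_dsmonom c u v : dscoef (dsmonom c u) v = c * (v == u)%:R.
Proof.
case: u v => [[i a] b] [[j a'] b'] /=.
rewrite coefCM coefXn; case: eqVneq => [->|ji]; last first.
  by rewrite mulr0 wpoly0 !mcoeff0 !xpair_eqE (negbTE ji) mulr0.
rewrite mulr1 wpoly_scale wpoly_dmon mcoeffZ mcoeffX !xpair_eqE eqxx /=.
rewrite [b == b']eq_sym [a' == a]eq_sym; case: eqVneq => _ /=.
  by rewrite mulr1 mcoeffZ mcoeffX andbT.
by rewrite mulr0 mcoeff0 andbF mulr0.
Qed.

End Coefficients.

(** * Normal forms *)

Section Groebner.
Variables (n : nat) (K : fieldType) (lt : rel (dsmon n)).
Hypothesis hlt : monomial_well_order lt.
Local Notation D := {poly (weyl n K)}.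
Local Notation lead := (leading lt).
Implicit Types (h : D) (u v w : dsmon n).

(** Infinite descent: w < 1 gives w^2 < w by compatibility with products, so w^2 < 1 is a smaller
    counterexample. *)
Lemma not_lt_dsmon1 w : ~ lt w (dsmon1 n).
Proof.
elim/(well_founded_ind (mwo_wf hlt)): w => w IH w1.
have ww : lt (dsmon_mul w w) w.
  by have := mwo_mul hlt w w1; rewrite [X in lt _ X]dsmon_mulC dsmon_mul1.
by apply: (IH _ ww); apply: (mwo_trans hlt) ww w1.
Qed.

Lemma lt_dsmon_mulr u w : w != dsmon1 n -> lt u (dsmon_mul u w).
Proof.
move=> w1; case/orP: (mwo_total hlt w1) => [/not_lt_dsmon1 // |].
move=> /(mwo_mul hlt u).
by rewrite dsmon_mulC dsmon_mul1 dsmon_mulC.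
Qed.

Lemma leading_exists h : h != 0 -> exists u, lead h u.
Proof.
move=> h0; have [u hu] : exists u, dscoef h u != 0.
  apply: NNPP => nu; case/eqP: h0; apply: dscoef_eq0 => u.
  by apply/eqP; apply: contraT => hu; case: nu; exists u.
have [s hs] := dscoef_supp h.
(* Maximum over a finite list containing the support, by induction on the list; [u] serves as the
   value for the empty list. *)
have: exists v, [/\ dscoef h v != 0 &
    forall w, dscoef h w != 0 -> w \in s -> w != v -> lt w v].
  elim: s {hs} => [|x s [v [hv lv]]]; first by exists u.
  have [hx0|hx] := eqVneq (dscoef h x) 0.
    exists v; split=> // w hw; rewrite inE => /orP[/eqP ew|]; last exact: lv.
    by rewrite ew hx0 eqxx in hw.
  have [exv|xv] := eqVneq x v.
    exists v; split=> // w hw; rewrite inE exv => /orP[->//|]; exact: lv.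
  case/orP: (mwo_total hlt xv) => ltxv.
    exists v; split=> // w hw; rewrite inE => /orP[/eqP->//|]; exact: lv.
  exists x; split=> // w hw; rewrite inE => /orP[-> //|ws wx].
  have [-> //|wv] := eqVneq w v.
  exact: (mwo_trans hlt) (lv _ hw ws wv) ltxv.
by case=> v [hv lv]; exists v; split=> // w hw; apply: lv => //; apply: hs.
Qed.

(** Translation by [e] preserves the order, so terms of [h'] lying below translates of monomials of
    [h] cannot overtake the translate of the leading one. *)
Lemma leading_shift h h' e u :
    lead h u -> dscoef h' (dsmon_mul u e) = dscoef h u ->
    (forall v, dscoef h' v != 0 -> exists2 w, dscoef h w != 0 &
       v = dsmon_mul w e \/ lt v (dsmon_mul w e)) ->
  lead h' (dsmon_mul u e).
Proof.
move=> [hu lu] hue hv; split=> [|v /hv[w hw vw]]; first by rewrite hue.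
have [ewu | wu vu] := eqVneq w u.
  by rewrite ewu in vw; case: vw => [->|//]; rewrite eqxx.
have := mwo_mul hlt e (lu _ hw wu).
by case: vw => [->//|]; apply: (mwo_trans hlt).
Qed.

Lemma leading_s h u : lead h u ->
  lead ('X * h) (dsmon_mul u (1%N, 0%MM, 0%MM)).
Proof.
move=> lu; apply: (leading_shift lu).
  by case: u {lu} => [[j a] b] /=; rewrite !addm0 addn1 coefXM.
move=> [[j a] b] /=; rewrite coefXM; case: j => [|j] /=.
  by rewrite !mcoeff0 eqxx.
by move=> hj; exists (j, a, b) => //=; left; rewrite !addm0 addn1.
Qed.

Lemma leading_x h u i : lead h u ->
  lead (dx 'X_i * h) (dsmon_mul u (0%N, U_(i)%MM, 0%MM)).
Proof.
move=> lu; apply: (leading_shift lu).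
  case: u {lu} => [[j a] b] /=; rewrite addn0 addm0.
  by rewrite coefCM -wscaleE wpoly_scale mcoeffZ mulrC addmC mcoeffMX.
move=> [[j a] b] /=; rewrite coefCM -wscaleE wpoly_scale mcoeffZ mulrC.
case/mcoeffMX_neq0 => a' -> ha; exists (j, a', b) => //; left.
by rewrite /= addn0 addm0 addmC.
Qed.

Lemma dscoef_d h i j (a b : 'X_{1..n}) :
  dscoef ((wd K i)%:P * h) (j, a, b) =
  (wpoly h`_j * 'X_i)@_b@_a + (wpoly h`_j)@_b@_(a + U_(i)) *+ (a i).+1.
Proof.
rewrite /= coefCM wdE wpoly_nabla mcoeffD mcoeffD mulrC; congr (_ + _).
by rewrite mcoeff_map_mpoly /= mcoeff_mderiv.
Qed.

(** Moving d_i past x^a d^b leaves the correction a_i x^(a-e_i) d^b, smaller than x^a d^(b+e_i) by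
    the factor [w] = x_i d_i, which exceeds 1. *)
Lemma leading_d h u i : lead h u ->
  lead ((wd K i)%:P * h) (dsmon_mul u (0%N, 0%MM, U_(i)%MM)).
Proof.
pose w : dsmon n := (0%N, U_(i)%MM, U_(i)%MM).
have w1 : w != dsmon1 n.
  apply/eqP => /(congr1 (fun x : dsmon n => x.2 i)); rewrite /=.
  by rewrite mnm1E eqxx mnm0E.
move=> lu; apply: (leading_shift lu).
  case: u lu => [[j a] b] [_ lu].
  rewrite [dsmon_mul _ _]/= addn0 addm0 dscoef_d [(b + _)%MM]addmC mcoeffMX.
  (* The correction to this coefficient comes from the monomial [u] times [w] of [h]; it is larger
     than the leading [u], so its coefficient is 0. *)
  rewrite [X in _ + X](_ : _ = 0) ?addr0 //.
  have [->|h0] := eqVneq (wpoly h`_j)@_(U_(i) + b)@_(a + U_(i)) 0.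
    by rewrite mul0rn.
  have lt1 := lt_dsmon_mulr (j, a, b) w1.
  have /lu : dscoef h (dsmon_mul (j, a, b) w) != 0.
    by rewrite /= addn0 [(b + _)%MM]addmC.
  have [e|_ /(_ isT) lt2] := eqVneq (dsmon_mul (j, a, b) w) (j, a, b).
    by rewrite e (mwo_irr hlt) in lt1.
  by have := mwo_trans hlt lt1 lt2; rewrite (mwo_irr hlt).
move=> [[j a] b]; rewrite dscoef_d => hv.
(* If the product term vanishes, [v] comes from differentiating x^(a+e_i) d^b, whose translate is
   [v] times [w]; otherwise [v] is itself a translate. *)
have [h1|h1] := eqVneq (wpoly h`_j * 'X_i)@_b@_a 0.
  exists (j, (a + U_(i))%MM, b).
    by apply: contraNneq hv => /= h2; rewrite h1 h2 mul0rn addr0.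
  by right; rewrite /= addm0; apply: lt_dsmon_mulr w1.
have : (wpoly h`_j * 'X_i)@_b != 0.
  by apply: contraNneq h1 => ->; rewrite mcoeff0.
case/mcoeffMX_neq0 => b' eb _; exists (j, a, b').
  by move: h1; rewrite eb mcoeffMX.
by left; rewrite /= addn0 addm0 addmC eb.
Qed.

Variable J : D -> Prop.
Hypothesis JD : forall h h', J h -> J h' -> J (h + h').
Hypothesis JM : forall h h', J h' -> J (h * h').

Lemma idealN h : J h -> J (- h).
Proof. by move=> /(JM (-1)); rewrite mulN1r. Qed.

Lemma idealB h h' : J h -> J h' -> J (h - h').
Proof. by move=> Jh /idealN; apply: JD. Qed.

(* Since 1 is the smallest monomial, the correction terms of normal ordering  *)
(* lie below the product of the monomials.                                    *)
Lemma leading_multiple h u v : J h -> lead h u -> dsmon_div u v ->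
  exists2 h', J h' & lead h' v.
Proof.
move=> Jh lu; case: u lu v => [[i a] b] lu [[j c] d] /= /and3P[ij ac bd].
pose S v := exists2 h', J h' & lead h' v.
apply: (_ : S (j, c, d)); have Su : S (i, a, b) by exists h.
apply: (@mnm_addm_ind n (fun x => S (j, c, x)) b d _ bd).
  move=> x k [h1 Jh1 l1]; have := leading_d k l1; rewrite /= addn0 addm0.
  by exists ((wd K k)%:P * h1) => //; apply: JM.
apply: (@mnm_addm_ind n (fun x => S (j, x, b)) a c _ ac).
  move=> x k [h1 Jh1 l1]; have := leading_x k l1; rewrite /= addn0 addm0.
  by exists (dx 'X_k * h1) => //; apply: JM.
rewrite -(subnKC ij); elim: (j - i)%N => [|k [h1 Jh1 /leading_s]].
  by rewrite addn0.
by rewrite /= !addm0 addn1 -addnS; exists ('X * h1) => //; apply: JM.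
Qed.

Variable G : seq D.
Hypothesis hG : groebner lt J G.
Hypothesis J0 : J 0.

Definition reduced (r : D) : Prop := forall v, dscoef r v != 0 ->
  forall h' u', h' \in G -> lead h' u' -> ~~ dsmon_div u' v.

Lemma reducedD r r' : reduced r -> reduced r' -> reduced (r + r').
Proof.
move=> rr rr' v; rewrite dscoefD; have [->|/rr //] := eqVneq (dscoef r v) 0.
by rewrite add0r; apply: rr'.
Qed.

Lemma reducedCM (c : K) r : reduced r -> reduced (dx c%:MP_[n] * r).
Proof.
move=> rr v; rewrite dscoefCM mulf_eq0 negb_or => /andP[_]; exact: rr.
Qed.

Lemma reduced0 : reduced 0.
Proof. by move=> v; rewrite dscoef0 eqxx. Qed.

(** Otherwise the leading monomial of [r] would be divisible by one of [G]. This is the uniqueness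
    of normal forms. *)
Lemma reduced_ideal r : reduced r -> J r -> r = 0.
Proof.
move=> rr Jr; apply/eqP; apply: contraT => /leading_exists[u lu].
have [h' [u' [h'G lu' du]]] := hG.2 r u Jr lu.
by have := rr u lu.1 h' u' h'G lu'; rewrite du.
Qed.

Lemma leading_sub h t u : lead h u -> lead t u -> dscoef t u = dscoef h u ->
  forall v, lead (h - t) v -> lt v u.
Proof.
move=> [_ lh] [_ l] e v [hv _].
have vu : v != u by apply: contraNneq hv => ->; rewrite dscoefB e subrr.
move: hv; rewrite dscoefB; have [hv0|hv _] := eqVneq (dscoef h v) 0.
  by rewrite hv0 sub0r oppr_eq0 => tv; apply: l.
exact: lh.
Qed.

(** The division algorithm, by well-founded induction on the leading monomial: a leading term is
    cancelled by an element of [J] if some leading monomial of [G] divides it, and otherwise moved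
    to the remainder. *)
Lemma normal_form_exists h : exists r, J (r - h) /\ reduced r.
Proof.
have [->|/leading_exists[u]] := eqVneq h 0.
  by exists 0; rewrite subrr; split=> //; apply: reduced0.
elim/(well_founded_ind (mwo_wf hlt)): u h => u IH h lu.
(* Both cases subtract some [t] with the same leading term as [h], which lowers the leading
   monomial. *)
have {}IH t : lead t u -> dscoef t u = dscoef h u ->
    exists r, J (r - (h - t)) /\ reduced r.
  move=> ltu etu; have [->|/leading_exists[v lv]] := eqVneq (h - t) 0.
    by exists 0; rewrite subrr; split=> //; apply: reduced0.
  by apply: (IH v) => //; apply: leading_sub lu ltu etu v lv.
case: (classic (exists h' u', [/\ h' \in G, lead h' u' & dsmon_div u' u])).
  move=> [h' [u' [h'G lu' du]]].
  have [t Jt [t0 tu]] := leading_multiple (hG.1 _ h'G) lu' du.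
  pose c := dscoef h u / dscoef t u.
  have [||r [Jr rr]] := IH (dx c%:MP_[n] * t).
  - split; first by rewrite dscoefCM divfK //; exact: lu.1.
    by move=> v; rewrite dscoefCM mulf_eq0 negb_or => /andP[_]; apply: tu.
  - by rewrite dscoefCM divfK.
  exists r; split=> //; set t' := dx _ * t in Jr.
  have -> : r - h = r - (h - t') - t'
    by rewrite opprB addrA [in RHS]addrAC addrK.
  by apply: idealB => //; apply: JM.
move=> irr.
have [||r [Jr rr]] := IH (dsmonom (dscoef h u) u).
- split; first by rewrite dscoef_dsmonom eqxx mulr1; exact: lu.1.
  by move=> v; rewrite dscoef_dsmonom; case: (v == u); rewrite ?mulr0 ?eqxx.
- by rewrite dscoef_dsmonom eqxx mulr1.
exists (r + dsmonom (dscoef h u) u); split.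
  by rewrite opprB addrA in Jr.
apply: reducedD => // v; rewrite dscoef_dsmonom; case: (eqVneq v u) => [->|].
  move=> _ h' u' h'G lu'; apply/negP => du; apply: irr.
  by exists h', u'.
by rewrite mulr0 eqxx.
Qed.

Lemma normal_formP h :
  J (normal_form lt J G h - h) /\ reduced (normal_form lt J G h).
Proof. exact: epsilon_spec (normal_form_exists h). Qed.

End Groebner.

(** * Coefficientwise partial derivatives on K[x][s] *)

Section PolyMderiv.
Variables (n : nat) (K : fieldType).
Implicit Types (i j : 'I_n).

Lemma map_mderivC i (p : {mpoly K[n]}) :
  map_poly (mderiv i) p%:P = (p^`M(i))%:P.
Proof.
apply/polyP => k; rewrite coef_map [in LHS]coefC [in RHS]coefC.
by case: (k == 0%N) => //; apply: raddf0.
Qed.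

Lemma map_mderivX i : map_poly (mderiv i) 'X = 0 :> {poly {mpoly K[n]}}.
Proof.
apply/polyP => k; rewrite coef_map [in LHS]coefX [in RHS]coef0.
by case: (k == 1%N); [apply: mderivC | apply: raddf0].
Qed.

Lemma map_mderiv_comm i j (p : {poly {mpoly K[n]}}) :
  map_poly (mderiv i) (map_poly (mderiv j) p) =
  map_poly (mderiv j) (map_poly (mderiv i) p).
Proof.
apply/polyP => k; rewrite coef_map coef_map [RHS]coef_map [in RHS]coef_map.
exact: mderiv_comm.
Qed.

End PolyMderiv.

(** * The Bernstein ideal of f/g *)

(** Euclidean division by a nonzero element of least size: the remainder lies in the ideal and is
    smaller, hence zero. *)
Lemma poly_ideal_principal (K : fieldType) (I : {poly K} -> Prop) :
    I 0 -> (forall b c, I b -> I c -> I (b + c)) ->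
    (forall b c, I c -> I (b * c)) ->
  exists b : {poly K}, (b \is monic \/ b = 0) /\ forall c, I c <-> b %| c.
Proof.
move=> I0 ID IM.
case: (classic (exists k b, [/\ I b, b != 0 & (size b <= k)%N])) => [[k]|nI].
  elim: k => [|k IH] [b [Ib b0 sb]].
    by rewrite leqn0 size_poly_eq0 (negbTE b0) in sb.
  (* Either a smaller nonzero element exists and induction applies, or [b] has least size. *)
  case: (classic (exists b, [/\ I b, b != 0 & (size b <= k)%N])) => // nI.
  have lb : lead_coef b != 0 by rewrite lead_coef_eq0.
  exists ((lead_coef b)^-1 *: b); split.
    by left; rewrite monicE lead_coefZ mulVf.
  move=> c; rewrite dvdpZl ?invr_eq0 //; split=> [Ic|]; last first.
    by case/dvdpP=> q ->; apply: IM.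
  rewrite /dvdp; apply: contraT => r0; case: nI; exists (c %% b); split=> //.
    have -> : c %% b = c + (- (c %/ b)) * b.
      by rewrite {2}(divp_eq c b) mulNr addrAC subrr add0r.
    by apply: ID => //; apply: IM.
  by rewrite -ltnS; apply: leq_trans sb; rewrite ltn_modp.
exists 0; split; first by right.
move=> c; rewrite dvd0p; split=> [Ic|/eqP-> //]; apply: contraT => c0.
by case: nI; exists (size c), c.
Qed.

Section Bernstein.
Variables (n : nat) (K : fieldType) (f g : {mpoly K[n]}).
Local Notation F := {fraction {poly {mpoly K[n]}}}.
Local Notation D := {poly (weyl n K)}.
Implicit Types (u v : F) (i j : 'I_n) (p q : {mpoly K[n]}).
Hypotheses (f0 : f != 0) (g0 : g != 0).

Lemma fracderivD i u v : fracderiv i (u + v) = fracderiv i u + fracderiv i v.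
Proof. exact/fracderD/map_mderivM. Qed.

Lemma fracderivM i u v :
  fracderiv i (u * v) = fracderiv i u * v + u * fracderiv i v.
Proof. exact/fracderM/map_mderivM. Qed.

Lemma fracderivC i j u :
  fracderiv i (fracderiv j u) = fracderiv j (fracderiv i u).
Proof.
exact: (fracderC u (@map_mderivM n K i) (@map_mderivM n K j)
  (map_mderiv_comm i j)).
Qed.

Lemma fracderiv_x i p : fracderiv i (fracx p) = fracx p^`M(i).
Proof. by rewrite /fracx -map_mderivC; apply/fracder_tofrac/map_mderivM. Qed.

Lemma fracderiv_s i : fracderiv i (fracs n K) = 0.
Proof.
by rewrite -tofrac0 -(map_mderivX K i); apply/fracder_tofrac/map_mderivM.
Qed.

Lemma fracx_neq0 p : p != 0 -> fracx p != 0.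
Proof. by rewrite tofrac_eq0 polyC_eq0. Qed.

Let fx : {rmorphism {mpoly K[n]} -> F} := @FracField.tofrac _ \o polyC.
Let ev : {rmorphism {poly {mpoly K[n]}} -> F} := @FracField.tofrac _.

Let twisted := tideal fx (fracs n K) (@fracderiv n K) f g.

(** The concrete notions are convertible to the abstract ones, so the results on the twisted action
    transfer directly. *)
Let J_idealE m N : J_ideal f g m N = twisted m N.
Proof. by []. Qed.

Let bernstein_idealE m N : bernstein_ideal f g m N =
  tbernstein fx (fracs n K) (@fracderiv n K) f g ev m N.
Proof. by []. Qed.

Let fxf0 : fx f != 0 := fracx_neq0 f0.
Let fxg0 : fx g != 0 := fracx_neq0 g0.
Let evC p : ev p%:P = fx p. Proof. by []. Qed.
Let evX : ev 'X = fracs n K. Proof. by []. Qed.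
Let der_fx i p : fracderiv i (fx p) = fx p^`M(i) := fracderiv_x i p.

Lemma J_ideal0 m N : J_ideal f g m N 0.
Proof. by rewrite J_idealE; apply: tideal0. Qed.

Lemma J_idealD m N h h' :
  J_ideal f g m N h -> J_ideal f g m N h' -> J_ideal f g m N (h + h').
Proof. by rewrite J_idealE; apply: tidealD. Qed.

Lemma J_idealM m N h h' : J_ideal f g m N h' -> J_ideal f g m N (h * h').
Proof.
rewrite J_idealE.
exact: (tidealM fracderivD fracderivM fracderivC der_fx fracderiv_s fxf0 fxg0).
Qed.

Lemma bernstein_ideal0 m N : bernstein_ideal f g m N 0.
Proof. by rewrite bernstein_idealE; apply: tbernstein0. Qed.

Lemma bernstein_idealD m N b c : bernstein_ideal f g m N b ->
  bernstein_ideal f g m N c -> bernstein_ideal f g m N (b + c).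
Proof. by rewrite bernstein_idealE; apply: tbernsteinD. Qed.

Lemma bernstein_idealM m N b c :
  bernstein_ideal f g m N c -> bernstein_ideal f g m N (b * c).
Proof.
rewrite bernstein_idealE.
exact: (tbernsteinM fracderivD fracderivM fracderivC der_fx fracderiv_s
  fxf0 fxg0 evC evX).
Qed.

Lemma bernstein_idealP m N (b : {poly K}) k : (size b <= k)%N ->
  bernstein_ideal f g m N b <->
  J_ideal f g m N (\sum_(i < k) dx (b`_i)%:MP_[n] * ('X^i * dx (g ^+ N))).
Proof.
rewrite bernstein_idealE J_idealE.
exact: (tbernsteinP fracderivD fracderivM fracderivC der_fx fracderiv_s
  fxf0 fxg0 evC evX).
Qed.

Lemma bernstein_polyP m N : let b := bernstein_poly f g m N in
  (b \is monic \/ b = 0) /\ forall c, bernstein_ideal f g m N c <-> b %| c.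
Proof.
exact: (epsilon_spec (inhabits 0) _ (poly_ideal_principal
  (bernstein_ideal0 m N) (@bernstein_idealD m N) (@bernstein_idealM m N))).
Qed.

(** * Relations among the normal forms of s^k g^N *)

Variables (m N : nat) (lt : rel (dsmon n)) (G : seq D).
Hypotheses (hlt : monomial_well_order lt)
  (hG : groebner lt (J_ideal f g m N) G).

Let P k := normal_form lt (J_ideal f g m N) G ('X^k * dx (g ^+ N)).

(** The left-hand sum S is reduced and congruent modulo J to T = b(s) g^N. Hence S = 0 iff T lies in
    J, which [bernstein_idealP] turns into divisibility. *)
Lemma normal_form_relation (b : {poly K}) k : (size b <= k)%N ->
  \sum_(i < k) dx (b`_i)%:MP_[n] * P i = 0 <-> bernstein_poly f g m N %| b.
Proof.
move=> sb; pose X (e : nat) : D := 'X^e * dx (g ^+ N).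
have PP e := normal_formP hlt (@J_idealD m N) (@J_idealM m N) hG
  (J_ideal0 m N) (X e).
have [_ <-] := bernstein_polyP m N; rewrite (bernstein_idealP m N sb).
set S := \sum_(i < k) _; set T := \sum_(i < k) _.
have JST : J_ideal f g m N (S - T).
  rewrite -sumrB; apply: (big_ind (J_ideal f g m N)); first exact: J_ideal0.
    exact: J_idealD.
  by move=> i _; rewrite -mulrBr; apply: J_idealM; case: (PP (i : nat)).
have redS : reduced lt G S.
  apply: (big_ind (reduced lt G)); first exact: reduced0.
    exact: reducedD.
  by move=> i _; apply: reducedCM; case: (PP (i : nat)).
split=> [S0|JT].
  by rewrite -[T]opprK -[- T]add0r -S0; apply: (idealN (@J_idealM m N)).
apply: (reduced_ideal hlt hG redS).
by rewrite -(subrK T S); apply: J_idealD.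
Qed.

Lemma monic_relationP k (a : nat -> K) :
  monic_relation P k a <->
  a k = 1 /\ bernstein_poly f g m N %| \poly_(i < k.+1) a i.
Proof.
rewrite -(normal_form_relation (size_poly _ _)).
suff -> : \sum_(i < k.+1) dx ((\poly_(i < k.+1) a i)`_i)%:MP_[n] * P i =
  \sum_(i < k.+1) dx (a i)%:MP_[n] * P i by [].
apply: eq_bigr => i _; congr (dx (_)%:MP_[n] * _).
by rewrite coef_poly ltn_ord.
Qed.

Hypothesis hb : bernstein_poly f g m N != 0.

Lemma bernstein_poly_monic : bernstein_poly f g m N \is monic.
Proof. by move: hb; case: (bernstein_polyP m N) => -[//|->]; rewrite eqxx. Qed.

Lemma monic_relation_bernstein :
  monic_relation P (size (bernstein_poly f g m N)).-1
    (fun e => (bernstein_poly f g m N)`_e).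
Proof.
apply/monic_relationP; split; first exact: (monicP bernstein_poly_monic).
by rewrite prednK ?coefK ?dvdpp // lt0n size_poly_eq0.
Qed.

(** The generator divides the monic polynomial [A] of degree [k], and minimality against its own
    coefficients gives [k] <= its degree; monic polynomials that are associates are equal. *)
Lemma bernstein_poly_least_relation k a : monic_relation P k a ->
    (forall j : nat, (j < k)%N -> ~ exists a, monic_relation P j a) ->
  bernstein_poly f g m N = \sum_(i < k.+1) a i *: 'X^i.
Proof.
move=> /monic_relationP[ak bA] least; rewrite -poly_def.
set A := \poly_(i < k.+1) a i in bA *.
have sA : size A = k.+1 by rewrite size_poly_eq // ak oner_neq0.
have mA : A \is monic.
  by rewrite monicE lead_coefE sA coef_poly ltnSn ak.
apply/eqP; rewrite -eqp_monic ?bernstein_poly_monic // -dvdp_size_eqp //.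
rewrite eqn_leq (dvdp_leq (monic_neq0 mA) bA) sA.
rewrite -[size _]prednK ?lt0n ?size_poly_eq0 // ltnS leqNgt.
apply/negP => /least; apply; eexists; exact: monic_relation_bernstein.
Qed.

End Bernstein.

Theorem mainTheorem4 (R : realType) (n : nat) (f g : {mpoly R[i][n]})
    (hf : (1 < msize f)%N) (hg : (1 < msize g)%N) (m N : nat) (hN : (1 <= N)%N)
    (lt : rel (dsmon n)) (hlt : monomial_well_order lt)
    (hb : bernstein_poly f g m N != 0)
    (G : seq {poly (weyl n R[i])}) (hG : groebner lt (J_ideal f g m N) G) :
  let P := fun k : nat =>
    normal_form lt (J_ideal f g m N) G ('X^k * dx (g ^+ N)) in
  (exists k a, monic_relation P k a) /\
  forall k : nat,
    (exists a, monic_relation P k a) ->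
    (forall j : nat, (j < k)%N -> ~ exists a, monic_relation P j a) ->
    (k = 0%N <-> P 0%N = 0) /\
    forall a : nat -> R[i], monic_relation P k a ->
      bernstein_poly f g m N = \sum_(i < k.+1) a i *: 'X^i.
Proof.
move=> P; have f0 : f != 0 by apply: contraTneq hf => ->; rewrite msize0.
have g0 : g != 0 by apply: contraTneq hg => ->; rewrite msize0.
split; first by do 2 eexists; exact: (monic_relation_bernstein f0 g0 hlt hG hb).
move=> k [a rel] least; split; last first.
  move=> a' rel'.
  exact: (bernstein_poly_least_relation f0 g0 hlt hG hb rel').
split=> [k0|P0].
  case: rel; rewrite k0 big_ord1 => ->.
  have -> : dx 1%:MP_[n] = 1 :> {poly (weyl n R[i])}.
    by rewrite /dx wx_scale1 mpolyC1 wscale1.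
  by rewrite mul1r.
(* If P_0 = 0, the constant sequence 1 is a monic relation at 0, so [k > 0] would contradict
   minimality. *)
apply/eqP; rewrite -leqn0 leqNgt; apply/negP => /least; apply.
by exists (fun=> 1); split; rewrite // big_ord1 P0 mulr0.
Qed.
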